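(* Let $\mathcal H$ be a Banach space, $\Theta$ a locally compact space, $\Theta\ni z\mapsto \mathcal X_z\in \mathrm{Grass}(\mathcal H)$ a function, and $z_0\in\Theta$. (1) If there exist an open set $\Theta_0$ with $z_0\in\Theta_0\subset\Theta$ and an injective resolution of $z\mapsto\mathcal X_z$ on $\Theta_0$ which is continuous (in operator norm) at $z_0$, then $z\mapsto \mathcal X_z$ is continuous at $z_0$ in the gap topology. (2) If moreover $\mathcal X_z\in\mathrm{Grass}_{\rm com}(\mathcal H)$ for all $z\in\Theta$, then the converse also holds: $z\mapsto\mathcal X_z$ is continuous at $z_0$ in the gap topology if and only if there exist an open $\Theta_0$ with $z_0\in\Theta_0\subset\Theta$ and an injective resolution of $z\mapsto\mathcal X_z$ on $\Theta_0$ continuous at $z_0$.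
   Context: $\mathrm{Grass}(\mathcal H)$ is the set of closed subspaces of $\mathcal H$. $\mathrm{Grass}_{\rm com}(\mathcal H)$ is the set of those closed subspaces $\mathcal X$ possessing a closed complementary subspace $\mathcal Y$ (i.e. $\mathcal X\cap\mathcal Y=\{0\}$, $\mathcal X+\mathcal Y=\mathcal H$). For $\mathcal X,\mathcal Y\in\mathrm{Grass}(\mathcal H)$ put $\delta(\mathcal X,\mathcal Y)=\sup\{\mathrm{dist}(x,\mathcal Y): x\in\mathcal X,\ \|x\|\le 1\}$ and $\hat\delta(\mathcal X,\mathcal Y)=\max(\delta(\mathcal X,\mathcal Y),\delta(\mathcal Y,\mathcal X))$ (the gap). The gap topology on $\mathrm{Grass}(\mathcal H)$ is the weakest topology for which $\delta$ is continuous on $\mathrm{Grass}(\mathcal H)\times\mathrm{Grass}(\mathcal H)$; continuity of $z\mapsto\mathcal X_z$ at $z_0$ in it amounts to $\hat\delta(\mathcal X_z,\mathcal X_{z_0})\to0$ as $z\to z_0$. For Banach spaces $\mathcal K,\mathcal H$, $\mathcal B_{\rm linv}(\mathcal K,\mathcal H)$ is the set of bounded everywhere defined injective operators $\mathcal K\to\mathcal H$ with closed range. An injective resolution of $z\mapsto\mathcal X_z$ on $\Theta_0$ is a function $\Theta_0\ni z\mapsto T_z\in\mathcal B_{\rm linv}(\mathcal K,\mathcal H)$, for some Banach space $\mathcal K$, such that for every $z\in\Theta_0$, $T_z$ is a bijection of $\mathcal K$ onto $\mathcal X_z$. *)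

(* Defs.v *)
From HB Require Import structures.
From mathcomp Require Export all_boot all_order all_algebra.
From mathcomp Require Export complex.
From mathcomp Require Export all_classical all_reals all_analysis.

Set Implicit Arguments.
Unset Strict Implicit.
Unset Printing Implicit Defensive.

Export Order.TTheory GRing.Theory Num.Theory.
Export numFieldNormedType.Exports.

Local Open Scope classical_set_scope.
Local Open Scope ring_scope.

(* Banach spaces are real or complex: [scalar_field R k] is R or R[i]. *)
Variant scalar_kind := RealScalars | ComplexScalars.

Definition scalar_field (R : realType) (k : scalar_kind) : numFieldType :=
  match k with RealScalars => R | ComplexScalars => R[i] end.

Definition real_part (R : realType) (k : scalar_kind) :
    scalar_field R k -> R :=
  match k return scalar_field R k -> R with
  | RealScalars => id
  | ComplexScalars => @complex.Re R
  end.
Arguments real_part {R k}.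

(* The norm [`|x|] of a normed module over R[i] is an element of R[i] (with
   zero imaginary part); [rnorm] is the same number read in R, where suprema
   and infima live. *)
Definition rnorm (R : realType) (k : scalar_kind)
    (V : normedModType (scalar_field R k)) (x : V) : R := real_part `|x|.

Section Grassmannian.
Context {R : realType} {k : scalar_kind}.
Implicit Type H : normedModType (scalar_field R k).

Record Grass H := MkGrass {
  Grass_set :> set H ;
  Grass_submod : submod_closed [in Grass_set] ;
  Grass_closed : closed Grass_set }.

HB.instance Definition _ H := gen_eqMixin (Grass H).
HB.instance Definition _ H := gen_choiceMixin (Grass H).

Definition Grass_com H : set (Grass H) := [set X | exists Y : Grass H,
  X `&` Y = [set 0] /\ [set x + y | x in X & y in Y] = [set: H]].

Definition dist H (x : H) (Y : set H) : R := inf [set rnorm (x - y) | y in Y].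

Definition delta H (X Y : Grass H) : R :=
  sup [set dist x Y | x in X `&` [set x | rnorm x <= 1]].

Definition is_topology (T : Type) (op : set_system T) :=
  [/\ op setT,
      forall A B, op A -> op B -> op (A `&` B) &
      forall F : set_system T, F `<=` op -> op (\bigcup_(A in F) A)].

(* Continuity of [delta] for the product topology on Grass(H) x Grass(H). *)
Definition makes_delta_continuous H (op : set_system (Grass H)) :=
  forall (X Y : Grass H) (e : R), 0 < e -> exists U V : set (Grass H),
    [/\ op U, op V, U X, V Y &
        forall X' Y', U X' -> V Y' -> `|delta X' Y' - delta X Y| < e].

(* The intersection of all topologies making [delta] continuous. It makes
   [delta] continuous too, hence is the weakest such topology: it is the
   topology of the gap max (delta X Y) (delta Y X), because
   delta X Z <= delta X Y + (1 + delta X Y) * delta Y Z. *)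
Definition gap_open H : set_system (Grass H) := [set U |
  forall op, is_topology op -> makes_delta_continuous op -> op U].

Lemma gap_openT H : gap_open [set: Grass H].
Proof. by move=> op []. Qed.

Lemma gap_openI H : setI_closed (@gap_open H).
Proof.
by move=> A B oA oB op top cop; case: (top) => _ + _; apply;
  [exact: oA | exact: oB].
Qed.

Lemma gap_open_bigU H (I : Type) (f : I -> set (Grass H)) :
  (forall i, gap_open (f i)) -> gap_open (\bigcup_i f i).
Proof.
move=> of_ op top cop; case: (top) => _ _ /(_ (range f)).
by rewrite bigcup_image; apply => _ [i _ <-]; exact: of_.
Qed.

HB.instance Definition _ H :=
  isOpenTopological.Build (Grass H) (@gap_openT H) (@gap_openI H)
    (@gap_open_bigU H).

End Grassmannian.

Section Resolutions.
Context {R : realType} {k : scalar_kind}.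
Implicit Types K H : normedModType (scalar_field R k).

Definition B_linv K H : set {linear K -> H} := [set T |
  [/\ bounded_near T (nbhs (0 : K)), injective T & closed (range T)]].

(* Meaningful for bounded [T] only: [sup] is 0 on unbounded sets. *)
Definition op_norm K H (T : K -> H) : R :=
  sup [set rnorm (T x) | x in [set x | rnorm x <= 1]].

(* Only the values [T z] for [z] in [Theta0] matter. *)
Definition injective_resolution (Theta : Type) K H
    (X : Theta -> Grass H) (Theta0 : set Theta) (T : Theta -> {linear K -> H}) :=
  forall z, Theta0 z -> B_linv (T z) /\ set_bij [set: K] (X z) (T z).

Definition norm_continuous_at (Theta : topologicalType) K H
    (T : Theta -> {linear K -> H}) (z0 : Theta) :=
  op_norm (fun x => T z x - T z0 x) @[z --> z0] --> (0 : R).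

End Resolutions.

(* Main.v *)
From HB Require Import structures.
Require Import Defs.
From mathcomp Require Import ring lra.

Set Implicit Arguments.
Unset Strict Implicit.
Unset Printing Implicit Defensive.

Local Open Scope classical_set_scope.
Local Open Scope ring_scope.

(* Continuity for the weakest topology making [delta] continuous is continuity
   for the gap: by the inequality
   1 + delta X Z <= (1 + delta X Y) (1 + delta Y Z), gap balls are the
   neighbourhoods of a topology for which [delta] is continuous.
   (1) T_{z0} is bounded below on K, since its inverse is bounded on the Banach
   space X_{z0}; so y = T_{z0} x and T_z x are close relative to their norms
   when T_z - T_{z0} is small.
   (2) If Y is a closed complement of X_{z0}, the projection P on X_{z0} along Y
   is bounded. If X_z is close to X_{z0}, then P is close to the identity on X_z,
   hence bounded below there, and successive approximation shows that it maps
   X_z onto X_{z0}. The inverses X_{z0} -> X_z of these restrictions of P form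
   the resolution, with K = X_{z0}. *)

Lemma half_expr_lt (R : realType) (C e : R) : 0 < e -> exists n, C * 2^-1 ^+ n < e.
Proof.
move=> e0.
have : (C * 2^-1 ^+ n) @[n --> \oo] --> (C * 0 : R).
  apply: cvgMr; apply: cvg_expr; rewrite ger0_norm ?invr_ge0 // invf_lt1 //; lra.
rewrite mulr0 => /cvgr0Pnorm_lt /(_ e e0) [N _ /(_ N (leqnn N)) /= NP].
by exists N; apply: le_lt_trans NP; exact: ler_norm.
Qed.

(** * Real-valued norms, Baire category and boundedness of seminorms *)

Section RealNorm.
Context {R : realType} {k : scalar_kind}.
Implicit Types V : normedModType (scalar_field R k).

(** The inclusion of the reals in the scalar field, inverse to [real_part] on nonnegative scalars.
    Norm inequalities transfer along it, so once its basic properties are known the two kinds of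
    scalars are treated together. *)
Definition real_scalar : R -> scalar_field R k :=
  match k with RealScalars => id | ComplexScalars => @real_complex R end.

Lemma real_scalarK (a : R) : real_part (real_scalar a) = a.
Proof. by rewrite /real_scalar /real_part; case: k. Qed.

Lemma real_partK (x : scalar_field R k) : 0 <= x -> real_scalar (real_part x) = x.
Proof.
rewrite /real_scalar /real_part; case: k x => //= -[x y].
by rewrite lecE /= => /andP[/eqP -> _].
Qed.

Lemma ler_real_scalar (a b : R) : (real_scalar a <= real_scalar b) = (a <= b).
Proof. by rewrite /real_scalar; case: k => //=; rewrite lecR. Qed.

Lemma ltr_real_scalar (a b : R) : (real_scalar a < real_scalar b) = (a < b).
Proof. by rewrite /real_scalar; case: k => //=; rewrite ltcR. Qed.

Lemma real_scalar0 : real_scalar 0 = 0.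
Proof. by rewrite /real_scalar; case: k. Qed.

Lemma real_scalar1 : real_scalar 1 = 1.
Proof. by rewrite /real_scalar; case: k. Qed.

Lemma real_scalarD (a b : R) : real_scalar (a + b) = real_scalar a + real_scalar b.
Proof. by rewrite /real_scalar; case: k => //=; rewrite rmorphD. Qed.

Lemma real_scalarM (a b : R) : real_scalar (a * b) = real_scalar a * real_scalar b.
Proof. by rewrite /real_scalar; case: k => //=; rewrite rmorphM. Qed.

Lemma normr_real_scalar (a : R) : `|real_scalar a| = real_scalar `|a|.
Proof.
rewrite /real_scalar; case: k => //=; rewrite normc_def /= expr0n /= addr0.
by rewrite sqrtr_sqr.
Qed.

Lemma rnormE V (x : V) : `|x| = real_scalar (rnorm x).
Proof. by rewrite /rnorm real_partK. Qed.

Lemma rnorm_ge0 V (x : V) : 0 <= rnorm x.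
Proof. by rewrite -ler_real_scalar -rnormE real_scalar0. Qed.

Lemma ler_rnormD V (x y : V) : rnorm (x + y) <= rnorm x + rnorm y.
Proof. by rewrite -ler_real_scalar real_scalarD -!rnormE ler_normD. Qed.

Lemma rnormN V (x : V) : rnorm (- x) = rnorm x.
Proof. by rewrite /rnorm normrN. Qed.

Lemma rnormB V (x y : V) : rnorm (x - y) = rnorm (y - x).
Proof. by rewrite -rnormN opprB. Qed.

Lemma ler_rnormB V (x y : V) : rnorm (x - y) <= rnorm x + rnorm y.
Proof. by rewrite -(rnormN y) ler_rnormD. Qed.

Lemma ler_rdistD V (y x z : V) : rnorm (x - z) <= rnorm (x - y) + rnorm (y - z).
Proof. by have := ler_rnormD (x - y) (y - z); rewrite addrA subrK. Qed.

Lemma rnorm0 V : rnorm (0 : V) = 0.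
Proof. by rewrite /rnorm normr0 -real_scalar0 real_scalarK. Qed.

Lemma rnorm_le0 V (x : V) : rnorm x <= 0 -> x = 0.
Proof.
move=> x0; apply/eqP; rewrite -normr_eq0 rnormE.
by rewrite (@le_anti _ _ (rnorm x) 0) ?real_scalar0 // x0 rnorm_ge0.
Qed.

Lemma rnormZ V (a : R) (x : V) : rnorm (real_scalar a *: x) = `|a| * rnorm x.
Proof.
by rewrite /rnorm normrZ normr_real_scalar rnormE -real_scalarM !real_scalarK.
Qed.

(** Radii of balls are positive scalars, and these are exactly the images of the positive reals. *)
Lemma nbhs_rnormP V (x : V) (A : set V) :
  nbhs x A <-> exists2 e : R, 0 < e & forall y, rnorm (x - y) < e -> A y.
Proof.
split=> [/nbhs_ballP[e /= e0 eA]|[e e0 eA]].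
  exists (real_part e).
    by rewrite -ltr_real_scalar real_partK ?ltW // real_scalar0.
  move=> y xy; apply: eA; rewrite -ball_normE /= rnormE.
  by rewrite -(real_partK (ltW e0)) ltr_real_scalar.
apply/nbhs_ballP; exists (real_scalar e) => /=.
  by rewrite -real_scalar0 ltr_real_scalar.
by move=> y; rewrite -ball_normE /= rnormE ltr_real_scalar; exact: eA.
Qed.

Lemma closed_rnorm V (A : set V) (x : V) : closed A ->
  (forall e : R, 0 < e -> exists2 y, A y & rnorm (x - y) < e) -> A x.
Proof.
move=> cA Ax; apply: cA => B /nbhs_rnormP[e e0 eB].
by have [y Ay xy] := Ax e e0; exists y; split=> //; exact: eB.
Qed.

(** The increments are dominated by a geometric series, so [u] is Cauchy; the increments from stage
    [n] on sum to at most [2 * c n]. *)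
Lemma geometric_cvg (V : completeNormedModType (scalar_field R k))
    (u : nat -> V) (c : nat -> R) :
  (forall n, rnorm (u n.+1 - u n) <= c n) -> (forall n, c n.+1 <= c n / 2) ->
  exists l, forall n, rnorm (l - u n) <= 2 * c n.
Proof.
move=> uc c2.
have c0 n : 0 <= c n by apply: le_trans (uc n); exact: rnorm_ge0.
have cX n m : c (n + m)%N <= c n * 2^-1 ^+ m.
  elim: m => [|m IH]; first by rewrite addn0 expr0 mulr1.
  by rewrite addnS exprSr mulrA; apply: le_trans (c2 _) _; rewrite ler_pM2r.
have um n m : rnorm (u (n + m)%N - u n) <= 2 * c n * (1 - 2^-1 ^+ m).
  elim: m => [|m IH]; first by rewrite addn0 subrr rnorm0 expr0 subrr mulr0.
  apply: le_trans (ler_rdistD (u (n + m)%N) _ _) _.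
  rewrite addnS; apply: le_trans (lerD (le_trans (uc _) (cX _ _)) IH) _.
  rewrite exprS; set t := _ ^+ m; lra.
have um' n m : (n <= m)%N -> rnorm (u m - u n) <= 2 * c n.
  move=> /subnKC <-; apply: le_trans (um _ _) _.
  by rewrite ler_piMr ?gerBl ?exprn_ge0 // mulr_ge0.
have small (e : R) : 0 < e -> exists N, 2 * c N < e.
  move=> /(half_expr_lt (2 * c 0%N))[N NP]; exists N; apply: le_lt_trans NP.
  by rewrite -mulrA ler_pM2l // -{1}[N]add0n.
have /cvg_ex[/= l ul] : cvg (u @ \oo).
  apply/cauchy_cvgP/cauchy_exP => e e0.
  have e0' : 0 < real_part e.
    by rewrite -ltr_real_scalar real_partK ?ltW // real_scalar0.
  have [N Ne] := small _ e0'; exists (u N), N => // m /= Nm.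
  rewrite -ball_normE /= rnormE -(real_partK (ltW e0)) ltr_real_scalar.
  by rewrite rnormB; apply: le_lt_trans Ne; exact: um'.
exists l => n; apply/ler_addgt0Pr => e e0.
have /ul[N _ Nl] : nbhs l [set y | rnorm (l - y) < e].
  by apply/nbhs_rnormP; exists e.
apply: le_trans (ler_rdistD (u (maxn n N)) _ _) _; rewrite addrC.
by apply: lerD; [exact/um'/leq_maxl | exact/ltW/Nl/leq_maxr].
Qed.

(** Baire's theorem: some [A n] is dense in a ball. Otherwise every ball contains a point at
    positive distance from [A n], and shrinking balls that avoid the sets one after the other close
    in on a point outside all of them. *)
Lemma Baire_ball (V : completeNormedModType (scalar_field R k))
    (A : nat -> set V) : (forall x, exists n, A n x) ->
  exists n x, exists2 r : R, 0 < r &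
    forall y, rnorm (y - x) < r ->
    forall e, 0 < e -> exists2 a, A n a & rnorm (y - a) < e.
Proof.
move=> Acover; apply: contrapT => nball.
have far n (x : V) (r : R) : 0 < r -> exists2 y, rnorm (y - x) < r &
    exists2 e : R, 0 < e & forall a, A n a -> e <= rnorm (y - a).
  move=> r0; apply: contrapT => nfar; apply: nball; exists n, x, r => // y yx e e0.
  apply: contrapT => na; apply: nfar; exists y => //; exists e => // a Aa.
  by rewrite leNgt; apply/negP => ya; apply: na; exists a.
(* [p] holds a stage, a centre and a radius; [q] holds the next centre and radius. The limit lies
   within twice the new radius of the new centre, so a clearance of four radii keeps it out of
   [A p.1]. *)
have step (p : nat * (V * R)) : exists q : V * R, 0 < p.2.2 ->
    [/\ 0 < q.2, q.2 <= p.2.2 / 2, rnorm (q.1 - p.2.1) < p.2.2 &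
        forall a, A p.1 a -> 4 * q.2 <= rnorm (q.1 - a)].
  case: p => n [x r] /=; have [r0|r0] := ltP 0 r; last by exists (x, r) => /=; rewrite ltNge r0.
  have [y yx [e e0 ye]] := far n x r r0.
  exists (y, Num.min (r / 2) (e / 4)) => _ /=; split=> //.
  - by rewrite lt_min !divr_gt0.
  - by rewrite ge_min lexx.
  - move=> a /ye; apply: le_trans.
    by rewrite mulrC -ler_pdivlMr // ge_min lexx orbT.
have [f fP] := choice step.
pose q := fix q n := if n is m.+1 then f (m, q m) else (0 : V, 1 : R).
have q0 n : 0 < (q n).2.
  by elim: n => [//|n IH] /=; have [] := fP (n, q n) IH.
have [l lq] : exists l, forall n, rnorm (l - (q n).1) <= 2 * (q n).2.
  apply: (geometric_cvg (u := fun n => (q n).1) (c := fun n => (q n).2)) => n.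
    by apply: ltW; have [] := fP (n, q n) (q0 n).
  by have [] := fP (n, q n) (q0 n).
have [n Al] := Acover l.
have [_ _ _ /(_ l Al)] := fP (n, q n) (q0 n).
have := q0 n.+1; have := lq n.+1; rewrite rnormB /=; lra.
Qed.

(* Zabreiko's lemma: a countably subadditive seminorm on a Banach space is
   bounded. Applied to [v |-> `|T^-1 v|] and [h |-> `|P h|], it replaces the open
   mapping and closed graph theorems. It is enough to test
   subadditivity on series that converge geometrically. *)
Lemma countably_subadditive_bounded
    (V : completeNormedModType (scalar_field R k)) (p : V -> R) :
  (forall x, 0 <= p x) ->
  (forall x y, p (x - y) <= p x + p y) ->
  (forall a x, p (real_scalar a *: x) <= `|a| * p x) ->
  (forall (x : nat -> V) (y : V) (C D : R),
     (forall n, p (x n) <= C * 2^-1 ^+ n) ->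
     (forall n, rnorm (y - \sum_(i < n) x i) <= D * 2^-1 ^+ n) ->
     p y <= 2 * C) ->
  exists2 M, 0 <= M & forall x, p x <= M * rnorm x.
Proof.
move=> p0 pB pZ psum.
(* The sublevel sets of [p] cover [V], so one of them is dense in a ball. *)
have [|n [x [r r0 xr]]] := @Baire_ball V (fun n => [set x | p x <= n%:R]).
  by move=> x; exists (Num.truncn (p x)).+1; exact/ltW/truncnS_gt.
(* Differences of points near [y + x] and near [x] move the ball to the origin, at the cost of
   doubling the bound on [p]. *)
have approx0 y : rnorm y < r -> forall e : R, 0 < e ->
    exists2 a, p a <= 2 * n%:R & rnorm (y - a) < e.
  move=> yr e e0; have e2 : 0 < e / 2 by lra.
  have [|a pa ya] := xr (y + x) _ _ e2; first by rewrite addrK.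
  have [|b pb xb] := xr x _ _ e2; first by rewrite subrr rnorm0.
  exists (a - b); first by apply: le_trans (pB _ _) _; rewrite mulr_natl mulr2n lerD.
  have -> : y - (a - b) = (y + x - a) - (x - b).
    by rewrite !opprB [y + x - a]addrAC [RHS]addrACA subrr addr0 addrA addrAC.
  by apply: le_lt_trans (ler_rnormB _ _) _; rewrite [e]splitr ltrD.
pose M := 4 * n%:R / r.
have M0 : 0 <= M by rewrite /M !mulr_ge0 // invr_ge0 ltW.
have approx y (e : R) : 0 < e ->
    exists2 a, p a <= M * rnorm y & rnorm (y - a) < e.
  move=> e0; have [y0|y0] := ltP 0 (rnorm y); last first.
    have -> := rnorm_le0 y0; exists 0; last by rewrite subrr rnorm0.
    by have := pZ 0 0; rewrite scaler0 normr0 mul0r rnorm0 mulr0.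
  (* Dividing [y] by [t] gives norm [r / 2], inside the ball; multiplying the bound [2 * n%:R] back
     by [t] gives [M * rnorm y]. *)
  pose t := 2 * rnorm y / r.
  have t0 : 0 < t by rewrite /t !mulr_gt0 ?invr_gt0.
  have [||a pa ya] := @approx0 (real_scalar t^-1 *: y) _ (e / t).
  - rewrite rnormZ gtr0_norm ?invr_gt0 // /t invf_div.
    rewrite invfM !mulrA divfK; lra.
  - by rewrite divr_gt0.
  exists (real_scalar t *: a).
    apply: le_trans (pZ _ _) _; rewrite gtr0_norm //.
    apply: le_trans (ler_wpM2l (ltW t0) pa) _.
    by rewrite le_eqVlt; apply/orP; left; apply/eqP; rewrite /t /M; field; rewrite gt_eqF.
  rewrite -[y in y - _]scale1r -real_scalar1 -(mulfV (lt0r_neq0 t0)).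
  rewrite real_scalarM -scalerA -scalerBr rnormZ gtr0_norm //.
  by rewrite mulrC -ltr_pdivlMr.
clearbody M; exists (2 * M) => [|y]; first by rewrite mulr_ge0.
have half_gt0 n' : 0 < 2^-1 ^+ n' :> R by rewrite exprn_gt0.
have [yle0|y_gt0] := leP (rnorm y) 0.
  have -> := rnorm_le0 yle0.
  by have := pZ 0 0; rewrite scaler0 normr0 mul0r rnorm0 mulr0.
(* Successive approximation: at stage [q.1] the remainder [q.2] is approximated so well that the
   next remainder is below [rnorm y * 2^-1 ^+ q.1.+1]. The corrections then sum to [y], and their
   [p]-values decay geometrically. *)
have next (q : nat * V) : exists a, p a <= M * rnorm q.2 /\
    rnorm (q.2 - a) < rnorm y * 2^-1 ^+ q.1.+1.
  by have [|a pa qa] := approx q.2 (rnorm y * 2^-1 ^+ q.1.+1); [rewrite mulr_gt0|exists a].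
have [f fP] := choice next.
pose z := fix z n := if n is m.+1 then z m - f (m, z m) else y.
have zn m : rnorm (z m) <= rnorm y * 2^-1 ^+ m.
  case: m => [|m]; first by rewrite expr0 mulr1.
  by have [_ /ltW] := fP (m, z m).
rewrite -mulrA; apply: (psum (fun m => f (m, z m)) y _ (rnorm y)) => m.
  have [pf _] := fP (m, z m); apply: le_trans pf _.
  by rewrite -mulrA; apply: ler_wpM2l => //; exact: zn.
suff -> : y - \sum_(i < m) f (val i, z i) = z m by [].
elim: m => [|m IH]; first by rewrite big_ord0 subr0.
by rewrite big_ord_recr /= opprD addrA IH.
Qed.

End RealNorm.

(** * The gap and its topology *)

Section Gap.
Context {R : realType} {k : scalar_kind}.
Variable H : normedModType (scalar_field R k).
Implicit Types X Y Z : Grass H.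

Lemma Grass0 X : Grass_set X 0.
Proof. by have [+ _] := Grass_submod X; rewrite inE. Qed.

Lemma Grass_lin X c x y : Grass_set X x -> Grass_set X y -> Grass_set X (c *: x + y).
Proof.
by have [_ XL] := Grass_submod X => Xx Xy; have := XL c x y; rewrite !inE; apply.
Qed.

Lemma GrassD X x y : Grass_set X x -> Grass_set X y -> Grass_set X (x + y).
Proof. by move=> Xx; rewrite -[x]scale1r; exact: Grass_lin. Qed.

Lemma GrassZ X c x : Grass_set X x -> Grass_set X (c *: x).
Proof. by move=> Xx; rewrite -[_ *: _]addr0; apply: Grass_lin => //; exact: Grass0. Qed.

Lemma GrassB X x y : Grass_set X x -> Grass_set X y -> Grass_set X (x - y).
Proof. by move=> Xx Xy; apply: GrassD => //; rewrite -scaleN1r; exact: GrassZ. Qed.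

Lemma Grass_sum X I (r : seq I) (u : I -> H) :
  (forall i, Grass_set X (u i)) -> Grass_set X (\sum_(i <- r) u i).
Proof.
by move=> Xu; elim/big_ind: _ => // [|x y]; [exact: Grass0|exact: GrassD].
Qed.

Lemma dist_has_inf X x : has_inf [set rnorm (x - y) | y in X].
Proof.
split; first by exists (rnorm (x - 0)), 0 => //; exact: Grass0.
by exists 0 => _ [y _ <-]; exact: rnorm_ge0.
Qed.

Lemma dist_le X x y : Grass_set X y -> dist x X <= rnorm (x - y).
Proof. by move=> Xy; apply: ge_inf; [case: (dist_has_inf X x)|exists y]. Qed.

Lemma dist_lt X x (e : R) : dist x X < e -> exists2 y, Grass_set X y & rnorm (x - y) < e.
Proof.
move=> xe; have e0 : 0 < e - dist x X by rewrite subr_gt0.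
have [_ [y Xy <-]] := inf_adherent e0 (dist_has_inf X x).
by rewrite [ltRHS]addrC subrK; exists y.
Qed.

Lemma delta_has_sup X Y :
  has_sup [set dist x Y | x in X `&` [set x | rnorm x <= 1]].
Proof.
split; first by exists (dist 0 Y), 0 => //; split; [exact: Grass0|rewrite /= rnorm0].
exists 1 => _ [x [_ x1] <-]; apply: le_trans x1.
by rewrite -[x in rnorm x]subr0; apply: dist_le; exact: Grass0.
Qed.

(** Normalizing [x] extends the bound from the unit ball to all of [X]. The strict inequality
    provides an actual [y], since the distance to [Y] need not be attained. *)
Lemma delta_approx X Y (e : R) x : delta X Y < e -> Grass_set X x ->
  exists2 y, Grass_set Y y & rnorm (x - y) <= e * rnorm x.
Proof.
move=> XYe Xx; have [x0|x0] := leP (rnorm x) 0.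
  by exists 0; [exact: Grass0|rewrite (rnorm_le0 x0) subrr rnorm0 mulr0].
have [|y Yy xy] := @dist_lt Y (real_scalar (rnorm x)^-1 *: x) e.
  apply: le_lt_trans XYe; apply: ub_le_sup; first by case: (delta_has_sup X Y).
  exists (real_scalar (rnorm x)^-1 *: x) => //; split; first exact: GrassZ.
  by rewrite /= rnormZ gtr0_norm ?invr_gt0 // mulVf ?gt_eqF.
exists (real_scalar (rnorm x) *: y); first exact: GrassZ.
rewrite -[x in x - _]scale1r -real_scalar1 -(mulfV (lt0r_neq0 x0)).
rewrite real_scalarM -scalerA -scalerBr rnormZ gtr0_norm // mulrC.
by rewrite ler_pM2r // ltW.
Qed.

Lemma delta_le X Y (e : R) :
  (forall x, Grass_set X x -> exists2 y, Grass_set Y y & rnorm (x - y) <= e * rnorm x) -> 0 <= e ->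
  delta X Y <= e.
Proof.
move=> XYe e0; apply: ge_sup; first by case: (delta_has_sup X Y).
move=> _ [x [Xx x1] <-]; have [y Yy xy] := XYe x Xx.
apply: le_trans (dist_le x Yy) _; apply: le_trans xy _.
exact: ler_piMr.
Qed.

Lemma delta_ge0 X Y : 0 <= delta X Y.
Proof.
apply: (@le_trans _ _ (dist 0 Y)).
  by apply: lb_le_inf; [case: (dist_has_inf Y 0)|move=> _ [y _ <-]; exact: rnorm_ge0].
apply: ub_le_sup; first by case: (delta_has_sup X Y).
by exists 0 => //; split; [exact: Grass0|rewrite /= rnorm0].
Qed.

Lemma delta_le1 X Y : delta X Y <= 1.
Proof.
apply: delta_le => // x _.
by exists 0; [exact: Grass0|rewrite subr0 mul1r].
Qed.

Lemma deltaxx X : delta X X = 0.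
Proof.
apply/eqP; rewrite eq_le delta_ge0 andbT; apply: delta_le => // x Xx.
by exists x; rewrite // subrr rnorm0 mul0r.
Qed.

(** Approximate [x] by [y] in [Y], then [y] by [z] in [Z]. The product term appears because the
    second error is relative to [rnorm y], which is at most [(1 + a) * rnorm x]. *)
Lemma delta_triangle X Y Z (a b : R) : delta X Y < a -> delta Y Z < b ->
  delta X Z <= a + b + a * b.
Proof.
move=> XYa YZb; have a0 := le_lt_trans (delta_ge0 X Y) XYa.
have b0 := le_lt_trans (delta_ge0 Y Z) YZb.
apply: delta_le => [x Xx|]; last by rewrite !addr_ge0 ?mulr_ge0 ?ltW.
have [y Yy xy] := delta_approx XYa Xx; have [z Zz yz] := delta_approx YZb Yy.
exists z => //; apply: le_trans (ler_rdistD y _ _) _.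
have yx : rnorm y <= rnorm x + a * rnorm x.
  by rewrite -[y in rnorm y](subKr x); apply: le_trans (ler_rnormB _ _) _; rewrite lerD2l.
have := ler_wpM2l (ltW b0) yx; lra.
Qed.

Definition gap_ball X (e : R) : set (Grass H) :=
  [set Y | delta X Y < e /\ delta Y X < e].

(** In any topology making [delta] continuous, continuity at [(X, Y)] and at [(Y, X)], with [X] kept
    fixed, gives an open set around each [Y] of the ball inside the ball; the ball is the union of
    such sets. *)
Lemma gap_open_ball X (e : R) : 0 < e -> gap_open (gap_ball X e).
Proof.
move=> e0 op [opT opI opU] op_delta.
have -> : gap_ball X e =
    \bigcup_(A in [set A | op A /\ A `<=` gap_ball X e]) A.
  apply/seteqP; split=> [Y [XY YX]|Y [A [_ sA] /sA //]].
  have eXY : 0 < e - delta X Y by rewrite subr_gt0.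
  have eYX : 0 < e - delta Y X by rewrite subr_gt0.
  have [U [V [_ oV UX VY UV]]] := op_delta X Y _ eXY.
  have [U' [V' [oU' _ U'Y V'X UV']]] := op_delta Y X _ eYX.
  exists (V `&` U') => //; split; first exact: opI.
  move=> Z [VZ U'Z]; have := UV _ _ UX VZ; have := UV' _ _ U'Z V'X.
  by rewrite !ltr_distl => /andP[_ ?] /andP[_ ?]; split; lra.
by apply: opU => A [].
Qed.

Lemma gap_ball_center X (e : R) : 0 < e -> gap_ball X e X.
Proof. by move=> e0; split; rewrite deltaxx. Qed.

Lemma gap_ball_sub X Y (e : R) : gap_ball X e Y ->
  exists2 r : R, 0 < r & gap_ball Y r `<=` gap_ball X e.
Proof.
move=> [XY YX]; pose m := Num.max (delta X Y) (delta Y X).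
have me : m < e by rewrite gt_max XY.
have m0 : 0 <= m by rewrite le_max delta_ge0.
have [XYm YXm] : delta X Y <= m /\ delta Y X <= m by rewrite !le_max !lexx orbT.
(* [a] is the midpoint of [m] and [e], and [r] is such that the excess [r * (1 + a)] is only half of
   the room [e - a]. *)
pose a := (m + e) / 2; pose r := (e - m) / (4 * (1 + a)).
have a1 : 0 < 1 + a by rewrite /a; lra.
have r0 : 0 < r by rewrite /r divr_gt0 ?mulr_gt0 ?subr_gt0.
have re : r * (1 + a) = (e - m) / 4 by rewrite /r; field; lra.
have lt_e : a + r + a * r < e by rewrite /a in re *; lra.
have XYa : delta X Y < a by rewrite /a; lra.
have YXa : delta Y X < a by rewrite /a; lra.
exists r => // Z [YZ ZY]; split; apply: le_lt_trans lt_e.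
  exact: delta_triangle XYa YZ.
by rewrite [a + r]addrC [a * r]mulrC; exact: delta_triangle ZY YXa.
Qed.

(** [gap_open] is an intersection of topologies, so it suffices that the sets containing a gap ball
    around each of their points form one topology making [delta] continuous. *)
Lemma gap_open_sub_ball (U : set (Grass H)) X : gap_open U -> U X ->
  exists2 e : R, 0 < e & gap_ball X e `<=` U.
Proof.
pose op : set_system (Grass H) := [set U | forall X, U X ->
  exists2 e : R, 0 < e & gap_ball X e `<=` U].
have op_ball Y (e : R) : op (gap_ball Y e) by move=> Z; exact: gap_ball_sub.
move=> /(_ op) oU; suff : op U by exact.
apply: oU => [|Y Z e e0].
  split.
  - by move=> Y _; exists 1.
  - move=> A B oA oB Y [/oA[e e0 eA] /oB[r r0 rB]].
    exists (Num.min e r); first by rewrite lt_min e0.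
    move=> Z [+ +]; rewrite !lt_min => /andP[? ?] /andP[? ?].
    by split; [exact: eA|exact: rB].
  - move=> F oF Y [A FA AY]; have [e e0 eA] := oF A FA Y AY.
    by exists e => // Z /eA; exists A.
(* As [delta] and [r] are at most 1, two uses of the triangle inequality change [delta] by at most
   [12 * r], which is less than [e]. *)
pose r := Num.min 1 (e / 20).
have r0 : 0 < r by rewrite lt_min ltr01 divr_gt0.
have r1 : r <= 1 by rewrite ge_min lexx.
have re : 20 * r <= e by rewrite mulrC -ler_pdivlMr // ge_min lexx orbT.
have near_le X1 Y1 X2 Y2 : delta X2 X1 < r -> delta Y1 Y2 < r ->
    delta X2 Y2 < delta X1 Y1 + e.
  move=> X21 Y12; have d1 := delta_le1 X1 Y1.
  have d0 := delta_ge0 X1 Y1; set d := delta X1 Y1 in d0 d1 *.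
  have dr : delta X1 Y1 < d + r by rewrite ltrDl.
  have rd : r * d <= r by rewrite ler_piMr // ltW.
  have rr : r * r <= r by rewrite ler_piMr // ltW.
  have := delta_triangle X21 dr => X2Y1.
  have {}X2Y1 : delta X2 Y1 < d + 5 * r by lra.
  have := delta_triangle X2Y1 Y12; lra.
exists (gap_ball Y r), (gap_ball Z r).
split; try exact: op_ball; try exact: gap_ball_center.
move=> Y' Z' [YY' Y'Y] [ZZ' Z'Z]; rewrite ltr_distl.
have := near_le _ _ _ _ Y'Y ZZ'; have := near_le _ _ _ _ YY' Z'Z.
by move=> ? ?; apply/andP; split; lra.
Qed.

Lemma nbhs_gapP X (A : set (Grass H)) :
  nbhs X A <-> exists2 e : R, 0 < e & gap_ball X e `<=` A.
Proof.
rewrite nbhsE; split=> [[U [oU UX] UA]|[e e0 eA]].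
  by have [e e0 eU] := gap_open_sub_ball oU UX; exists e => //; exact: subset_trans UA.
exists (gap_ball X e) => //; split; last exact: gap_ball_center.
exact: gap_open_ball.
Qed.

End Gap.

(** * A closed subspace as a Banach space *)

Section GrassSubspace.
Context {R : realType} {k : scalar_kind}.
Variables (H : completeNormedModType (scalar_field R k)) (X : Grass H).

Definition Grass_pred : {pred H} := [in Grass_set X].
HB.instance Definition _ := GRing.isSubmodClosed.Build _ H Grass_pred (Grass_submod X).

(** As a type with the restricted norm, [X] can be the domain of linear maps: the inverse of a
    resolution in part (1), and the resolution itself in part (2). *)
Record Grass_sub := MkGrassSub { Grass_val : H; Grass_valP : Grass_val \in Grass_pred }.
HB.instance Definition _ := [isSub for Grass_val].
HB.instance Definition _ := [Choice of Grass_sub by <:].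
HB.instance Definition _ := [SubChoice_isSubLmodule of Grass_sub by <:].

Let norm (x : Grass_sub) : scalar_field R k := `|val x|.
Let normD x y : norm (x + y) <= norm x + norm y.
Proof. by rewrite /norm linearD ler_normD. Qed.
Let normZ l x : norm (l *: x) = `|l| * norm x.
Proof. by rewrite /norm linearZ normrZ. Qed.
Let norm_eq0 x : norm x = 0 -> x = 0.
Proof. by move=> /normr0_eq0 x0; apply: val_inj; rewrite x0 linear0. Qed.
HB.instance Definition _ :=
  Lmodule_isNormed.Build (scalar_field R k) Grass_sub normD normZ norm_eq0.

Lemma rnorm_Grass_val (x : Grass_sub) : rnorm (val x) = rnorm x.
Proof. by []. Qed.

Lemma Grass_sub_complete (F : set_system Grass_sub) :
  ProperFilter F -> cauchy F -> cvg F.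
Proof.
move=> FF Fc.
have /cvg_ex[/= l Fl] : cvg (val @ F).
  apply/cauchy_cvgP/cauchy_exP => e e0.
  move/cauchyP : Fc => /(_ e e0)[x Fx]; exists (val x).
  by move: Fx; rewrite /fmap /=; apply: filterS => y; rewrite -!ball_normE.
have Xl : Grass_set X l.
  apply: (closed_cvg _ (@Grass_closed _ _ _ X)) Fl; apply: nearW => x.
  by have := Grass_valP x; rewrite inE.
apply/cvg_ex; exists (MkGrassSub (mem_set Xl)).
apply/cvg_ballP => e e0; move/cvg_ballP : Fl => /(_ e e0).
by rewrite !near_map; apply: filterS => x; rewrite -!ball_normE.
Qed.

HB.instance Definition _ := Uniform_isComplete.Build Grass_sub Grass_sub_complete.

End GrassSubspace.

(** * Bounded linear maps and the operator norm *)

Section OpNorm.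
Context {R : realType} {k : scalar_kind}.
Variables K H : normedModType (scalar_field R k).
Implicit Type f : K -> H.

Lemma bounded_near_rnormP (T : {linear K -> H}) :
  bounded_near T (nbhs (0 : K)) <->
  exists2 C : R, 0 <= C & forall x, rnorm (T x) <= C * rnorm x.
Proof.
split=> [[M [Mreal MT]]|[C C0 CT]].
  pose c := real_part (`|M| + 1).
  have cE : real_scalar c = `|M| + 1 by rewrite real_partK // addr_ge0.
  have : M < real_scalar c by rewrite cE (le_lt_trans (real_ler_norm Mreal)) ?ltrDl.
  move=> /MT /nbhs_rnormP[e e0 eT].
  have c0 : 0 <= c by rewrite -(@ler_real_scalar R k) cE real_scalar0 addr_ge0.
  exists (2 * c / e) => [|x]; first by rewrite !mulr_ge0 ?invr_ge0 // ltW.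
  have [x0|x0] := leP (rnorm x) 0.
    by rewrite (rnorm_le0 x0) linear0 !rnorm0 mulr0.
  (* [t] scales [x] to norm [e / 2], inside the ball where [T] is bounded by [c]. *)
  pose t := e / (2 * rnorm x).
  have t0 : 0 < t by rewrite /t divr_gt0 ?mulr_gt0.
  have : rnorm (0 - real_scalar t *: x) < e.
    rewrite sub0r rnormN rnormZ gtr0_norm //.
    rewrite (_ : t * _ = e / 2); last by rewrite /t; field; rewrite gt_eqF.
    lra.
  move=> /eT; rewrite /= linearZ /= rnormE ler_real_scalar rnormZ gtr0_norm //.
  rewrite mulrC -ler_pdivlMr // => /le_trans; apply.
  by rewrite /t le_eqVlt; apply/orP; left; apply/eqP; field; rewrite !gt_eqF.
exists (real_scalar C); split.
  by rewrite realE -real_scalar0 ler_real_scalar C0.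
move=> M CM; apply/nbhs_rnormP; exists 1 => // x.
rewrite sub0r rnormN => x1 /=; apply: le_trans (ltW CM).
rewrite rnormE ler_real_scalar; apply: le_trans (CT x) _.
by rewrite ler_piMr // ltW.
Qed.

Lemma op_norm_has_sup f (C : R) : (forall x, rnorm (f x) <= C * rnorm x) ->
  has_sup [set rnorm (f x) | x in [set x | rnorm x <= 1]].
Proof.
move=> fC; split; first by exists (rnorm (f 0)), 0 => //=; rewrite rnorm0.
have [C0|/ltW C0] := leP 0 C; [exists C|exists 0] => _ [x x1 <-].
  by apply: le_trans (fC x) _; rewrite ler_piMr.
by apply: le_trans (fC x) _; rewrite mulr_le0_ge0 // rnorm_ge0.
Qed.

Lemma op_norm_ge0 f (C : R) : (forall x, rnorm (f x) <= C * rnorm x) ->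
  0 <= op_norm f.
Proof.
move=> /op_norm_has_sup fsup; apply: le_trans (rnorm_ge0 (f 0)) _.
by apply: ub_le_sup; [case: fsup|exists 0; rewrite //= rnorm0].
Qed.

Lemma op_norm_le f (C : R) : 0 <= C -> (forall x, rnorm (f x) <= C * rnorm x) ->
  op_norm f <= C.
Proof.
move=> C0 fC; apply: ge_sup; first by case: (op_norm_has_sup fC).
by move=> _ [x x1 <-]; apply: le_trans (fC x) _; rewrite ler_piMr.
Qed.

(** The bound [C] ensures that [op_norm] is a genuine supremum. Plain homogeneous functions are
    allowed so that the lemma applies directly to pointwise differences of operators. *)
Lemma ler_op_norm f (C : R) x : (forall x, rnorm (f x) <= C * rnorm x) ->
  (forall a x, f (a *: x) = a *: f x) -> rnorm (f x) <= op_norm f * rnorm x.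
Proof.
move=> fC fZ; have [x0|x0] := leP (rnorm x) 0.
  by have := fC x; rewrite (rnorm_le0 x0) rnorm0 !mulr0.
rewrite -ler_pdivrMr //; apply: ub_le_sup; first by case: (op_norm_has_sup fC).
exists (real_scalar (rnorm x)^-1 *: x).
  by rewrite /= rnormZ gtr0_norm ?invr_gt0 // mulVf ?gt_eqF.
by rewrite fZ rnormZ gtr0_norm ?invr_gt0 // mulrC.
Qed.

End OpNorm.

(** * Lower bounds, projections and local resolutions *)

Section Resolution.
Context {R : realType} {k : scalar_kind}.
Variables H : completeNormedModType (scalar_field R k).

Lemma rnorm_half_expr0 (V : normedModType (scalar_field R k)) (C : R) (x : V) :
  (forall n, rnorm x <= C * 2^-1 ^+ n) -> x = 0.
Proof.
move=> xC; apply: rnorm_le0; apply/ler_addgt0Pr => e e0; rewrite add0r.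
have [n Cn] := half_expr_lt C e0.
exact: le_trans (xC n) (ltW Cn).
Qed.

Lemma geometric_series (V : completeNormedModType (scalar_field R k))
    (x : nat -> V) (C : R) : (forall n, rnorm (x n) <= C * 2^-1 ^+ n) ->
  exists l, forall n, rnorm (l - \sum_(i < n) x i) <= 2 * C * 2^-1 ^+ n.
Proof.
move=> xC.
have [|n|l lC] := @geometric_cvg _ _ V (fun n => \sum_(i < n) x i)
  (fun n => C * 2^-1 ^+ n).
- by move=> n; rewrite /= big_ord_recr /= addrAC subrr add0r.
- by rewrite exprSr mulrA.
- by exists l => n; rewrite -mulrA.
Qed.

(** The bounded inverse theorem. The norm of the inverse [S] is countably subadditive on [X]: if the
    series of the [S (x i)] converges to [l], then continuity of [T] gives [T l = y], that is
    [S y = l]. *)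
Lemma linv_lower_bound (K : completeNormedModType (scalar_field R k))
    (T : {linear K -> H}) (X : Grass H) :
  B_linv T -> set_bij [set: K] X T ->
  exists2 M : R, 0 <= M & forall x, rnorm x <= M * rnorm (T x).
Proof.
move=> [/bounded_near_rnormP[B B0 TB] Tinj _] [TX _ Tsurj].
have preim (v : Grass_sub X) : exists x, T x = val v.
  have /Tsurj[x _ <-] : Grass_set X (val v) by have := Grass_valP v; rewrite inE.
  by exists x.
have [S TS] := choice preim.
have SZ a v : S (a *: v) = a *: S v by apply: Tinj; rewrite linearZ /= !TS linearZ.
have SB u v : S (u - v) = S u - S v by apply: Tinj; rewrite linearB /= !TS linearB.
have [||||M M0 SM] := @countably_subadditive_bounded _ _ _ (fun v => rnorm (S v)).
- by move=> v; exact: rnorm_ge0.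
- by move=> u v; rewrite SB; exact: ler_rnormB.
- by move=> a v; rewrite SZ rnormZ.
- move=> x y C D /geometric_series[l lx] yx.
  suff -> : S y = l.
    by have := lx 0%N; rewrite big_ord0 subr0 expr0 mulr1.
  apply: Tinj; rewrite TS; apply/eqP; rewrite -subr_eq0; apply/eqP.
  (* Both [y] and [T l] are compared with the partial sums of [x]: [D] accounts for the first error,
     [B * (2 * C)] for the second. *)
  apply: (@rnorm_half_expr0 _ (D + B * (2 * C))) => n.
  apply: le_trans (ler_rdistD (val (\sum_(i < n) x i)) _ _) _.
  rewrite mulrDl; apply: lerD; first by rewrite -linearB; exact: yx.
  have -> : val (\sum_(i < n) x i) = T (\sum_(i < n) S (x i)).
    by rewrite !linear_sum; apply: eq_bigr => i _; rewrite TS.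
  rewrite -linearB; apply: le_trans (TB _) _.
  by rewrite -mulrA ler_wpM2l // rnormB.
- exists M => // x; have Xx : Grass_set X (T x) by exact: TX.
  have /= := SM (MkGrassSub (mem_set Xx)); rewrite -rnorm_Grass_val /=.
  by congr (rnorm _ <= _); apply: Tinj; rewrite TS.
Qed.

(** [P] takes the component in [X]. If the series of the [P (x i)] converges to [l], closedness of
    [X] and [Y] puts [l] in [X] and [y - l] in [Y], so [P y = l] by uniqueness of the
    decomposition. *)
Lemma complement_projection (X Y : Grass H) :
  X `&` Y = [set 0] -> [set x + y | x in X & y in Y] = [set: H] ->
  exists P : {linear H -> H}, [/\ forall h, Grass_set X (P h),
    forall x, Grass_set X x -> P x = x &
    exists2 M : R, 0 <= M & forall h, rnorm (P h) <= M * rnorm h].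
Proof.
move=> XY0 XYT.
have ex h : exists x, Grass_set X x /\ Grass_set Y (h - x).
  have : [set: H] h by []. 
  rewrite -XYT => -[x Xx [y Yy <-]]; exists x; split => //.
  by rewrite addrC addKr.
have [P PXY] := choice ex.
have Puniq h x : Grass_set X x -> Grass_set Y (h - x) -> P h = x.
  move=> Xx Yx; have [XP YP] := PXY h; apply/eqP; rewrite -subr_eq0; apply/eqP.
  have : (X `&` Y) (P h - x); last by rewrite XY0.
  split; first exact: GrassB.
  have -> : P h - x = (h - x) - (h - P h) by rewrite opprB [RHS]addrC addrA subrK.
  exact: GrassB.
have Plin : linear P.
  move=> a u v; have [Xu Yu] := PXY u; have [Xv Yv] := PXY v.
  apply: Puniq; first exact: Grass_lin.
  have -> : a *: u + v - (a *: P u + P v) = a *: (u - P u) + (v - P v).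
    by rewrite scalerBr opprD addrACA.
  exact: Grass_lin.
pose L : {linear H -> H} := HB.pack P (GRing.isLinear.Build _ _ _ _ P Plin).
exists L; split.
- by move=> h; case: (PXY h).
- by move=> x Xx; apply: Puniq => //; rewrite subrr; exact: Grass0.
apply: countably_subadditive_bounded => [h|u v|a h|x y C D Px yx].
- exact: rnorm_ge0.
- by rewrite linearB; exact: ler_rnormB.
- by rewrite linearZ rnormZ.
have [l lx] := geometric_series Px.
suff -> : L y = l by have := lx 0%N; rewrite big_ord0 subr0 expr0 mulr1.
apply: Puniq.
  apply: (closed_rnorm (@Grass_closed _ _ _ X)) => e e0.
  have [n ne] := half_expr_lt (2 * C) e0.
  exists (\sum_(i < n) L (x i)); last exact: le_lt_trans (lx n) ne.
  by apply: Grass_sum => i; case: (PXY (x i)).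
apply: (closed_rnorm (@Grass_closed _ _ _ Y)) => e e0.
have [n ne] := half_expr_lt (D + 2 * C) e0.
exists (\sum_(i < n) (x i - L (x i))).
  by apply: Grass_sum => i; case: (PXY (x i)).
have -> : y - l - \sum_(i < n) (x i - L (x i)) =
    (y - \sum_(i < n) x i) - (l - \sum_(i < n) L (x i)).
  by rewrite sumrB !opprD !opprK addrACA.
apply: le_lt_trans (ler_rnormB _ _) _; apply: le_lt_trans ne.
by rewrite mulrDl lerD.
Qed.

(** [T] inverts the restriction of [P] to [Z]. The condition on [e0] makes [P] differ from the
    identity on [Z] by at most half the norm; the last clause gives the rate at which [T] approaches
    the inclusion of [X]. *)
Lemma gap_ball_resolution (X Z : Grass H) (P : {linear H -> H}) (M e0 : R) :
  (forall h, Grass_set X (P h)) -> (forall x, Grass_set X x -> P x = x) ->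
  0 <= M -> (forall h, rnorm (P h) <= M * rnorm h) ->
  (1 + M) * e0 <= 2^-1 -> gap_ball X e0 Z ->
  exists T : {linear Grass_sub X -> H},
    [/\ B_linv T, set_bij [set: Grass_sub X] Z T &
        forall (e : R) y, delta Z X < e ->
          rnorm (T y - val y) <= 2 * (1 + M) * e * rnorm y].
Proof.
move=> XP Pid M0 PM Me0 [XZ ZX].
have e00 : 0 < e0 by exact: le_lt_trans (delta_ge0 X Z) XZ.
have near_id (e : R) x : delta Z X < e -> Grass_set Z x ->
    rnorm (x - P x) <= (1 + M) * e * rnorm x.
  move=> ZXe Zx; have [y Xy xy] := delta_approx ZXe Zx.
  have -> : x - P x = (x - y) - P (x - y).
    by rewrite linearB /= (Pid y) // opprB addrA subrK.
  apply: le_trans (ler_rnormB _ _) _; apply: le_trans (lerD (lexx _) (PM _)) _.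
  have := ler_wpM2l M0 xy; lra.
have lower x : Grass_set Z x -> rnorm x <= 2 * rnorm (P x).
  move=> Zx; have := near_id _ _ ZX Zx.
  have := ler_wpM2r (rnorm_ge0 x) Me0.
  have := ler_rnormD (x - P x) (P x); rewrite subrK; lra.
have surj y : Grass_set X y -> exists x, Grass_set Z x /\ P x = y.
  move=> Xy.
  (* For [q] in [X] and a nearby [x] in [Z], [q - P x = P (q - x)] has norm at most
     [M * e0 * rnorm q], so each correction halves the remainder. *)
  have next (q : H) : exists x, Grass_set X q ->
      [/\ Grass_set Z x, rnorm x <= 2 * rnorm q & rnorm (q - P x) <= rnorm q / 2].
    have [Xq|nXq] := EM (Grass_set X q); last by exists 0.
    have [x Zx qx] := delta_approx XZ Xq; exists x => _; split=> //.
      have := ler_rnormB q (q - x); rewrite subKr.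
      have := ler_wpM2r (rnorm_ge0 q) Me0.
      have := mulr_ge0 (mulr_ge0 M0 (ltW e00)) (rnorm_ge0 q); have := rnorm_ge0 q; lra.
    rewrite -{1}(Pid q) // -linearB; apply: le_trans (PM _) _.
    have := ler_wpM2l M0 qx; have := ler_wpM2r (rnorm_ge0 q) Me0.
    have := mulr_ge0 (ltW e00) (rnorm_ge0 q); lra.
  have [f fP] := choice next.
  pose z := fix z n := if n is m.+1 then z m - P (f (z m)) else y.
  have Xz n : Grass_set X (z n) by case: n => //= n; elim: n => [|n IH] /=; exact: GrassB.
  have zn n : rnorm (z n) <= rnorm y * 2^-1 ^+ n.
    elim: n => [|n IH]; first by rewrite expr0 mulr1.
    have [_ _ /le_trans] := fP _ (Xz n); apply.
    by rewrite exprSr mulrA ler_pM2r.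
  have /geometric_series[l lf] n : rnorm (f (z n)) <= 2 * rnorm y * 2^-1 ^+ n.
    have [_ /le_trans + _] := fP _ (Xz n); apply.
    by rewrite -mulrA ler_wpM2l.
  have Pf n : y - P (\sum_(i < n) f (z i)) = z n.
    elim: n => [|n IH]; first by rewrite big_ord0 linear0 subr0.
    by rewrite big_ord_recr linearD opprD addrA IH.
  exists l; split.
    apply: (closed_rnorm (@Grass_closed _ _ _ Z)) => e e_gt0.
    have [n ne] := half_expr_lt (2 * (2 * rnorm y)) e_gt0.
    exists (\sum_(i < n) f (z i)); last exact: le_lt_trans (lf n) ne.
    by apply: Grass_sum => i; case: (fP _ (Xz i)).
  apply/esym/eqP; rewrite -subr_eq0; apply/eqP.
  apply: (@rnorm_half_expr0 _ (rnorm y + M * (2 * (2 * rnorm y)))) => n.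
  apply: le_trans (ler_rdistD (P (\sum_(i < n) f (z i))) _ _) _.
  rewrite Pf mulrDl; apply: lerD => //.
  rewrite -linearB; apply: le_trans (PM _) _.
  by rewrite -mulrA ler_wpM2l // rnormB.
have val_in (v : Grass_sub X) : Grass_set X (val v).
  by have := Grass_valP v; rewrite inE.
have ex (v : Grass_sub X) : exists x, Grass_set Z x /\ P x = val v by exact: surj.
have [T TP] := choice ex.
have Puniq x y : Grass_set Z x -> Grass_set Z y -> P x = P y -> x = y.
  move=> Zx Zy Pxy; apply/eqP; rewrite -subr_eq0; apply/eqP/rnorm_le0.
  by have := lower _ (GrassB Zx Zy); rewrite linearB /= Pxy subrr rnorm0 mulr0.
have Tlin : linear T.
  move=> a u v; have [Zu Pu] := TP u; have [Zv Pv] := TP v.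
  apply: Puniq; [by case: (TP (a *: u + v))|exact: Grass_lin|].
  by rewrite linearP /= Pu Pv; case: (TP (a *: u + v)) => _ ->; rewrite linearP.
pose L : {linear Grass_sub X -> H} := HB.pack T (GRing.isLinear.Build _ _ _ _ T Tlin).
have Tle v : rnorm (T v) <= 2 * rnorm v.
  by have [Zv Pv] := TP v; have := lower _ Zv; rewrite Pv.
have Tinj : injective T.
  by move=> u v Tuv; apply: val_inj; case: (TP u) => _ <-; rewrite Tuv; case: (TP v).
have rangeT : range T = Grass_set Z.
  apply/seteqP; split=> [_ [v _ <-]|x Zx]; first by case: (TP v).
  (* The preimage of [x] under [T] is [P x], by injectivity of [P] on [Z]. *)
  exists (MkGrassSub (mem_set (XP x))) => //.
  by have [Zv Pv] := TP (MkGrassSub (mem_set (XP x))); apply: Puniq.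
exists L; split.
- split=> //; last by rewrite rangeT; exact: Grass_closed.
  by apply/bounded_near_rnormP; exists 2.
- split=> [v _|u v _ _|x]; [by case: (TP v)|exact: Tinj|].
  by rewrite -rangeT.
- move=> e v ZXe; have [Zv Pv] := TP v.
  rewrite -Pv; apply: le_trans (near_id _ _ ZXe Zv) _.
  have e_gt0 : 0 <= (1 + M) * e.
    by rewrite mulr_ge0 ?addr_ge0 // ltW // (le_lt_trans (delta_ge0 Z X)).
  have := ler_wpM2l e_gt0 (Tle v); lra.
Qed.

End Resolution.

(** * Continuous resolutions and gap continuity *)

Section Continuity.
Context {R : realType} {k : scalar_kind}.
Variables (H : completeNormedModType (scalar_field R k)) (Theta : topologicalType).
Variables (X : Theta -> Grass H) (z0 : Theta).

Definition continuous_resolution :=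
  exists (Theta0 : set Theta) (K : completeNormedModType (scalar_field R k))
         (T : Theta -> {linear K -> H}),
    [/\ open Theta0, Theta0 z0, injective_resolution X Theta0 T &
        norm_continuous_at T z0].

Lemma continuous_gapP : {for z0, continuous X} <->
  forall e : R, 0 < e -> \forall z \near z0, gap_ball (X z0) e (X z).
Proof.
split=> [Xc e e0|Xe A /nbhs_gapP[e e0 eA]].
  by apply: Xc; apply/nbhs_gapP; exists e.
by apply: filterS (Xe e e0) => z /eA.
Qed.

Lemma resolution_continuous : continuous_resolution -> {for z0, continuous X}.
Proof.
case=> U [K [T [oU Uz0 Tres Tcont]]].
have [Tz0 bijz0] := Tres _ Uz0.
have [M M0 TM] := linv_lower_bound Tz0 bijz0.
have [/bounded_near_rnormP[B0 _ TB0] _ _] := Tz0.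
have [im0 _ surj0] := bijz0.
apply/continuous_gapP => e e0.
(* The bound 1 on [d * (1 + M)] keeps [T z] bounded below with constant [2 * M]; the bound [e / 4]
   makes both values of [delta] at most [e / 2]. *)
pose d := Num.min 1 (e / 4) / (1 + M).
have M1 : 0 < 1 + M by lra.
have m0 : 0 < Num.min 1 (e / 4) by rewrite lt_min ltr01 divr_gt0.
have d0 : 0 < d by rewrite divr_gt0.
have dM : d * (1 + M) = Num.min 1 (e / 4) by rewrite /d divfK ?gt_eqF.
have dM1 : d * (1 + M) <= 1 by rewrite dM ge_min lexx.
have dMe : d * (1 + M) <= e / 4 by rewrite dM ge_min lexx orbT.
move/cvgr0Pnorm_lt : Tcont => /(_ (d / 2)); rewrite divr_gt0 // => /(_ isT) Tcont.
have Tnear := open_nbhs_nbhs (conj oU Uz0).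
near=> z.
have Uz : U z by near: z.
have [[/bounded_near_rnormP[B _ TB] _ _] [im _ surj]] := Tres _ Uz.
have diffB x : rnorm (T z x - T z0 x) <= (B + B0) * rnorm x.
  by apply: le_trans (ler_rnormB _ _) _; rewrite mulrDl lerD.
have diff x : rnorm (T z x - T z0 x) <= d / 2 * rnorm x.
  apply: le_trans (@ler_op_norm _ _ _ _ (fun x => T z x - T z0 x) _ x diffB _) _.
    by move=> a y; rewrite scalerBr !linearZ.
  apply: ler_wpM2r; first exact: rnorm_ge0.
  apply: le_trans (ler_norm _) _; apply: ltW; near: z; exact: Tcont.
have lower x : rnorm x <= 2 * M * rnorm (T z x).
  have := ler_wpM2l M0 (diff x); have := TM x; have := rnorm_ge0 x.
  have := ler_rdistD (T z x) (T z0 x) 0; rewrite !subr0 (rnormB (T z0 x)) => h.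
  have := ler_wpM2l M0 h; have := ler_wpM2r (rnorm_ge0 x) dM1.
  have := mulr_ge0 (ltW d0) (rnorm_ge0 x); lra.
have eM : d * M <= e / 4 by apply: le_trans dMe; rewrite ler_pM2l //; lra.
split; apply: (@le_lt_trans _ _ (e / 2)); try lra.
  apply: delta_le; last by rewrite divr_ge0 // ltW.
  move=> _ /surj0[x _ <-]; exists (T z x); first exact: im.
  rewrite rnormB; apply: le_trans (diff x) _.
  have := ler_wpM2l (ltW d0) (TM x); have := ler_wpM2r (rnorm_ge0 (T z0 x)) eM.
  have := mulr_ge0 (ltW e0) (rnorm_ge0 (T z0 x)); lra.
apply: delta_le; last by rewrite divr_ge0 // ltW.
move=> _ /surj[x _ <-]; exists (T z0 x); first exact: im0.
apply: le_trans (diff x) _.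
have := ler_wpM2l (ltW d0) (lower x); have := ler_wpM2r (rnorm_ge0 (T z x)) eM.
have := mulr_ge0 (ltW e0) (rnorm_ge0 (T z x)); lra.
Unshelve. all: by end_near. Qed.

(** One projection, onto [X z0], serves for every nearby [z], so all the [T z] share the domain
    [Grass_sub (X z0)]. *)
Lemma continuous_resolution_com : Grass_com (X z0) ->
  {for z0, continuous X} -> continuous_resolution.
Proof.
move=> [Y [XY0 XYT]] /continuous_gapP Xcont.
have {XY0 XYT} [P [XP Pid [M M0 PM]]] := complement_projection XY0 XYT.
have M1 : 0 < 1 + M by lra.
pose e0 : R := (2 * (1 + M))^-1.
have e0_gt0 : 0 < e0 by rewrite invr_gt0 mulr_gt0.
have Me0 : (1 + M) * e0 <= 2^-1.
  by rewrite le_eqVlt; apply/orP; left; apply/eqP; rewrite /e0; field; lra.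
have ex z : exists T : {linear Grass_sub (X z0) -> H}, gap_ball (X z0) e0 (X z) ->
    [/\ B_linv T, set_bij [set: Grass_sub (X z0)] (X z) T &
        forall (e : R) y, delta (X z) (X z0) < e ->
          rnorm (T y - val y) <= 2 * (1 + M) * e * rnorm y].
  (* Outside the ball the zero map is a default value, so that [T] is defined on all of [Theta]. *)
  have [g|ng] := EM (gap_ball (X z0) e0 (X z)); last by exists \0.
  by have [T TP] := gap_ball_resolution XP Pid M0 PM Me0 g; exists T.
have [T TP] := choice ex.
have [_ _ Tz0] := TP z0 (gap_ball_center _ e0_gt0).
(* Since [delta (X z0) (X z0) = 0], the rate holds with every positive constant; the factor [1 + n]
   in [d] avoids a division by zero. *)
have {}Tz0 y : T z0 y = val y.
  apply/eqP; rewrite -subr_eq0; apply/eqP/rnorm_le0/ler_addgt0Pr => e e_gt0.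
  have n0 := rnorm_ge0 y; set n := rnorm y in n0 *; rewrite add0r.
  pose d := e / (2 * (1 + M) * (1 + n)).
  have n1 : 0 < 1 + n by lra.
  have d0 : 0 < d by rewrite divr_gt0 // !mulr_gt0.
  apply: le_trans (Tz0 d y _) _; first by rewrite deltaxx.
  have -> : 2 * (1 + M) * d * n = e * (n / (1 + n)).
    by rewrite /d; field; rewrite !gt_eqF.
  by rewrite ler_piMr ?(ltW e_gt0) // ler_pdivrMr // mul1r lerDr.
(* Continuity is only given at [z0], so the set of good [z] is a neighbourhood of [z0] but need not
   be open; its interior is taken. *)
exists (interior [set z | gap_ball (X z0) e0 (X z)]), (Grass_sub (X z0)), T; split.
- exact: open_interior.
- exact: Xcont.
- by move=> z /interior_subset /TP[].
apply/cvgr0Pnorm_lt => e e_gt0.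
(* [e0] keeps [X z] in the ball where [T z] inverts [P]; the other bound makes the distance from
   [T z] to the inclusion at most [e / 2]. *)
pose d := Num.min e0 (e / (4 * (1 + M))).
have d0 : 0 < d by rewrite lt_min e0_gt0 divr_gt0 // mulr_gt0.
have de : 2 * (1 + M) * d <= e / 2.
  apply: (@le_trans _ _ (2 * (1 + M) * (e / (4 * (1 + M))))).
    by rewrite ler_pM2l ?mulr_gt0 // ge_min lexx orbT.
  by rewrite le_eqVlt; apply/orP; left; apply/eqP; field; lra.
apply: filterS (Xcont d d0) => z [Xd dX].
have gz : gap_ball (X z0) e0 (X z).
  by split; [apply: lt_le_trans Xd _|apply: lt_le_trans dX _]; rewrite ge_min lexx.
have [_ _ Tz] := TP z gz.
have diff x : rnorm (T z x - T z0 x) <= e / 2 * rnorm x.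
  rewrite Tz0; apply: le_trans (Tz d x dX) _.
  by apply: ler_wpM2r de; exact: rnorm_ge0.
rewrite ger0_norm; last exact: op_norm_ge0 diff.
apply: le_lt_trans (op_norm_le _ diff) _; lra.
Qed.

End Continuity.

Theorem proposition3p22 (R : realType) (k : scalar_kind)
    (H : completeNormedModType (scalar_field R k))
    (Theta : topologicalType) (Theta_lc : locally_compact [set: Theta])
    (X : Theta -> Grass H) (z0 : Theta) :
  ((exists (Theta0 : set Theta)
           (K : completeNormedModType (scalar_field R k))
           (T : Theta -> {linear K -> H}),
      [/\ open Theta0, Theta0 z0, injective_resolution X Theta0 T &
          norm_continuous_at T z0]) ->
    {for z0, continuous X}) /\
  ((forall z, Grass_com (X z)) ->
    ({for z0, continuous X} <->
     exists (Theta0 : set Theta)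
            (K : completeNormedModType (scalar_field R k))
            (T : Theta -> {linear K -> H}),
      [/\ open Theta0, Theta0 z0, injective_resolution X Theta0 T &
          norm_continuous_at T z0])).
Proof.
split; first exact: resolution_continuous.
move=> Xcom; split; last exact: resolution_continuous.
exact: continuous_resolution_com.
Qed.
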